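(* Let $\mathbf{c}=(c_1,\dots,c_n)\in\mathbb{Z}_{>0}^n$ and let $k$ be a positive integer. Then the Ehrhart polynomial of $\mathscr{R}_{k,\mathbf{c}}$ is given by \[ \operatorname{ehr}(\mathscr{R}_{k,\mathbf{c}},t)=\sum_{j=0}^{k-1}(-1)^j\sum_{v=0}^{k-1}\binom{t(k-v)+n-1-j}{n-1}\rho_{\mathbf{c},j}(v); \] in particular, for every positive integer $t$, $\#(t\mathscr{R}_{k,\mathbf{c}}\cap\mathbb{Z}^n)$ equals the right-hand side.
   Context: $\mathscr{R}_{k,\mathbf{c}}=\{x\in\mathbb{R}^n : 0\le x_i\le c_i \text{ for all } i,\ \sum_i x_i=k\}$. For $0\le j\le n$ and integer $s$, $\rho_{\mathbf{c},j}(s)$ is the number of $j$-element subsets $I\subseteq[n]$ with $\sum_{i\in I}c_i=s$ (so $\rho_{\mathbf{c},0}(s)=1$ if $s=0$ and $0$ otherwise); set $\rho_{\mathbf{c},j}=0$ for $j>n$. The binomial coefficient $\binom{y}{n-1}=\frac{y(y-1)\cdots(y-n+2)}{(n-1)!}$ is regarded as a polynomial in $y$. *)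

(* Defs.v *)
From mathcomp Require Export all_boot all_order all_algebra.
From mathcomp Require Export classical_sets cardinality reals.
From mathcomp Require Import boolp.

Set Implicit Arguments.
Unset Strict Implicit.
Unset Printing Implicit Defensive.

Import Order.TTheory GRing.Theory Num.Theory.
Local Open Scope ring_scope.
Local Open Scope classical_set_scope.
Local Open Scope card_scope.

Definition Zlattice (R : realType) (n : nat) : set 'rV[R]_n :=
  [set x | forall i, x ord0 i \is a Num.int].

Definition dilate (R : realType) (n : nat) (t : R) (P : set 'rV[R]_n) :
  set 'rV[R]_n := [set t *: x | x in P].

Definition is_ehrhart (R : realType) (n : nat) (P : set 'rV[R]_n)
    (p : {poly R}) : Prop :=
  forall t : nat, (0 < t)%N ->
    exists2 m : nat, dilate t%:R P `&` @Zlattice R n #= `I_m &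
      p.[t%:R] = m%:R.

(* Defaults to 0 when P has no Ehrhart polynomial; by [is_ehrhart_uniq] below
   there is at most one. *)
Definition ehr (R : realType) (n : nat) (P : set 'rV[R]_n) : {poly R} :=
  xget 0 [set p | is_ehrhart P p].

Lemma is_ehrhart_uniq (R : realType) (n : nat) (P : set 'rV[R]_n)
    (p q : {poly R}) :
  is_ehrhart P p -> is_ehrhart P q -> p = q.
Proof.
move=> hp hq; apply/eqP; rewrite -subr_eq0; apply/negPn/negP => nz.
pose s : seq R := [seq i.+1%:R | i <- iota 0 (size (p - q))].
have us : uniq s.
  rewrite map_inj_uniq ?iota_uniq // => i j /eqP.
  by rewrite eqr_nat => /eqP [].
have rs : all (root (p - q)) s.
  apply/allP => _ /mapP[i _ ->]; rewrite rootE !hornerE.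
  have [m mP ->] := hp i.+1 isT; have [m' m'P ->] := hq i.+1 isT.
  rewrite subr_eq0 eqr_nat; apply/eqP/card_eq_II.
  by apply: card_eq_trans m'P; rewrite card_eq_sym.
by have := max_poly_roots nz rs us; rewrite size_map size_iota ltnn.
Qed.

Lemma ehrE (R : realType) (n : nat) (P : set 'rV[R]_n) (p : {poly R}) :
  is_ehrhart P p -> ehr P = p.
Proof.
by move=> hp; apply: xget_unique => // q hq; apply: is_ehrhart_uniq hq hp.
Qed.

Definition slice (R : realType) (n k : nat) (c : 'I_n -> nat) :
    set 'rV[R]_n :=
  [set x | (forall i, 0 <= x ord0 i <= (c i)%:R) /\ \sum_i x ord0 i = k%:R].

(* The polynomial y (y - 1) ... (y - m + 1) / m! in the indeterminate y. *)
Definition binomp (R : realType) (m : nat) : {poly R} :=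
  (m`!%:R)^-1 *: \prod_(i < m) ('X - i%:R%:P).

Definition rho (n : nat) (c : 'I_n -> nat) (j : nat) (s : int) : nat :=
  #|[set I : {set 'I_n} | (#|I| == j) && ((\sum_(i in I) c i)%N%:Z == s)]%SET|.

(* Main.v *)
(** The lattice points of the t-th dilate are the y in N^n with y_i <= t c_i and
    sum t k.  Inclusion-exclusion over the set I of violated upper bounds,
    followed by stars and bars, writes their number as the sum over all I of
    (-1)^|I| binom(M + n - 1, n - 1), where M = t (k - c(I)) - |I| and a term
    with M < 0 counts as 0.  Since |I| <= c(I), grouping the sets I with
    c(I) < k by (|I|, c(I)) gives the formula: if c(I) >= k then M < 0, and if
    c(I) < k then M + n - 1 >= 0, so that the polynomial binomial coefficient
    vanishes by itself when M < 0. *)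

Require Import Defs.
From mathcomp Require Import zify.

Set Implicit Arguments.
Unset Strict Implicit.
Unset Printing Implicit Defensive.

Import GRing.Theory Num.Theory.
Local Open Scope ring_scope.
Local Open Scope classical_set_scope.
Local Open Scope card_scope.

(** Bridge from counting in a finite type to set-theoretic cardinality: [enum A] indexes the image
    of [A]. The point [x0] only serves as the default of [nth]. *)
Lemma card_eq_imset (T : finType) (U : Type) (f : T -> U) (A : {set T})
    (x0 : T) :
  injective f -> [set f x | x in [set` A]] #= `I_#|A|.
Proof.
move=> f_inj.
have -> : [set f x | x in [set` A]] =
    [set f (nth x0 (enum A) i) | i in `I_#|A|].
  apply/seteqP; split=> [_ [x /= xA <-]|_ [i /= iA <-]].
    exists (index x (enum A)); last by rewrite nth_index ?mem_enum.
    by rewrite /= cardE index_mem mem_enum.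
  by exists (nth x0 (enum A) i) => //=; rewrite -mem_enum mem_nth // -cardE.
apply: inj_card_eq => i j; rewrite !inE /= => iA jA /f_inj /eqP.
by rewrite nth_uniq ?enum_uniq -?cardE // => /eqP.
Qed.

(** Subtracting [d] gives a bijection with the compositions of [N - D], which stars and bars counts.
    The case distinction is essential: for [N < D] truncated subtraction would yield ['C(m, m) = 1]
    instead of 0. *)
Lemma card_compositions_ge m N (d : 'I_m.+1 -> nat) :
  #|[set y : {ffun 'I_m.+1 -> 'I_N.+1} |
      (\sum_i y i == N)%N && [forall i, d i <= y i]%N]%SET| =
  (if (\sum_i d i <= N)%N then 'C(m + (N - \sum_i d i), m) else 0%N).
Proof.
set D := (\sum_i d i)%N; case: leqP => [DN|ND]; last first.
  apply/eqP; rewrite cards_eq0; apply/eqP/setP => y; rewrite !inE.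
  apply/negP => /andP[/eqP yN /forallP dy].
  by move: ND; rewrite ltnNge => /negP; apply; rewrite -yN; apply: leq_sum.
rewrite -card_ord_partitions.
set B := [set z : m.+1.-tuple 'I_(N - D).+1 | (\sum_(i <- z) i == N - D)%N]%SET.
(* The inverse shift; [inord] never falls back to its default here, since an entry is at most
   [N - D] and [d i <= D]. *)
pose g (z : m.+1.-tuple 'I_(N - D).+1) : {ffun 'I_m.+1 -> 'I_N.+1} :=
  [ffun i => inord (tnth z i + d i)].
have zB z : z \in B -> (\sum_i tnth z i = N - D)%N.
  by rewrite inE big_tuple => /eqP.
have dD i : (d i <= D)%N by rewrite /D (bigD1 i) //= leq_addr.
have gE z i : g z i = (tnth z i + d i)%N :> nat.
  rewrite ffunE inordK // ltnS.
  have := ltn_ord (tnth z i); rewrite ltnS => zi.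
  by rewrite (leq_trans (leq_add zi (dD i))) // subnK.
have g_inj : injective g.
  move=> z w gzw; apply: eq_from_tnth => i; apply: val_inj.
  by apply/eqP; rewrite /= -(eqn_add2r (d i)) -!gE gzw.
rewrite -(card_imset _ g_inj); apply: eq_card => y; rewrite inE.
apply/andP/imsetP => [[/eqP yN /forallP dy]|[z /zB zN ->]]; last first.
  split; last by apply/forallP => i; rewrite gE leq_addl.
  by rewrite (eq_bigr _ (fun i _ => gE z i)) big_split /= zN subnK.
have sumE : (\sum_i (y i - d i) = N - D)%N.
  by rewrite sumnB ?yN.
have yd i : (y i - d i < (N - D).+1)%N.
  by rewrite ltnS -sumE (bigD1 i) //= leq_addr.
exists [tuple inord (y i - d i) | i < m.+1].
  rewrite inE big_tuple; apply/eqP; rewrite -[RHS]sumE.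
  by apply: eq_bigr => i _; rewrite tnth_mktuple inordK.
apply/ffunP => i; apply: val_inj.
by rewrite /= gE tnth_mktuple inordK // subnK.
Qed.

(** Inclusion-exclusion: the indicator of all upper bounds is a product of factors
    [1 - (b i < y i)], expanded over the set [I] of indices whose bound is violated. *)
Lemma card_compositions_le (R : comPzRingType) m N (b : 'I_m.+1 -> nat) :
  (#|[set y : {ffun 'I_m.+1 -> 'I_N.+1} |
      (\sum_i y i == N)%N && [forall i, y i <= b i]%N]%SET|)%:R =
  \sum_(I : {set 'I_m.+1}) (-1) ^+ #|I| *
    (if (\sum_(i in I) (b i).+1 <= N)%N
     then 'C(m + (N - \sum_(i in I) (b i).+1), m) else 0%N)%:R :> R.
Proof.
pose S := [set y : {ffun 'I_m.+1 -> 'I_N.+1} | (\sum_i y i == N)%N]%SET.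
have cardS (P : pred {ffun 'I_m.+1 -> 'I_N.+1}) :
    #|[set y : {ffun 'I_m.+1 -> 'I_N.+1} | (\sum_i y i == N)%N && P y]%SET|%:R =
    \sum_(y in S) (P y)%:R :> R.
  rewrite -sum1_card natr_sum big_mkcond [RHS]big_mkcond /=.
  by apply: eq_bigr => y _; rewrite !inE; case: eqP => //= _; case: (P y).
have allE (Q : pred 'I_m.+1) : [forall i, Q i]%:R = \prod_i (Q i)%:R :> R.
  case: forallP => [Qall|nQ].
    by rewrite big1 // => i _; rewrite Qall.
  have [i /negbTE Qi] : exists i, ~~ Q i.
    by apply/existsP; rewrite -negb_forall; apply/forallP.
  by rewrite (bigD1 i) //= Qi mul0r.
rewrite cardS.
under eq_bigr => y _.
  rewrite allE.
  under eq_bigr => i _.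
    (* The violation comes first in the sum so that [bigA_distr] picks it exactly for [i] in [I]. *)
    have -> : (y i <= b i)%:R = - (b i < y i)%:R + 1 :> R.
      by case: leqP => _; rewrite ?oppr0 ?add0r ?addNr.
    over.
  rewrite bigA_distr /=.
  over.
rewrite exchange_big /=; apply: eq_bigr => I _.
(* A violated bound is the lower bound [(b i).+1]; the value 0 outside [I] imposes nothing. *)
pose d i := if i \in I then (b i).+1 else 0%N.
have dE : (\sum_(i in I) (b i).+1 = \sum_i d i)%N.
  by rewrite big_mkcond.
rewrite dE -card_compositions_ge cardS big_distrr /=.
apply: eq_bigr => y _; rewrite allE -prodr_const [X in _ = X * _]big_mkcond.
rewrite -big_split /=; apply: eq_bigr => i _; rewrite /d.
by case: ifP => _; rewrite ?mulN1r ?mul1r.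
Qed.

Lemma binomp_nat (R : realType) m x : (binomp R m).[x%:R] = 'C(x, m)%:R.
Proof.
have ffactE : \prod_(i < m) (x%:R - i%:R) = (x ^_ m)%:R :> R.
  elim: m => [|m IH]; first by rewrite big_ord0 ffactn0.
  rewrite big_ord_recr /= IH ffactnSr natrM.
  (* For [x < m] the difference [x - m] is negative in [R] but truncated in [nat]; the preceding
     factorial [x ^_ m] is then already 0. *)
  have [mx|xm] := leqP m x; first by rewrite natrB.
  by rewrite ffact_small // !mul0r.
rewrite /binomp hornerZ horner_prod.
under eq_bigr do rewrite hornerXsubC.
rewrite ffactE -bin_ffact natrM mulrCA mulVf ?mulr1 //.
by rewrite pnatr_eq0 -lt0n fact_gt0.
Qed.

Lemma sum_delta (R : pzRingType) k (h : nat -> R) (a : nat) :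
  \sum_(j < k) h j * (a == j)%:R = if (a < k)%N then h a else 0.
Proof.
case: ltnP => [ak|ka].
  rewrite (bigD1 (Ordinal ak)) //= eqxx mulr1 big1 ?addr0 // => j.
  by rewrite -val_eqE /= eq_sym => /negbTE ->; rewrite mulr0.
rewrite big1 // => j _.
by rewrite gtn_eqF ?mulr0 // (leq_trans (ltn_ord j)).
Qed.

(** Each set [I] is counted by [rho] at the single pair formed by its size and its weight, so it
    survives once if both are below [k], and not at all otherwise. *)
Lemma sum_rho (R : comPzRingType) n (c : 'I_n -> nat) k
    (h : nat -> nat -> R) :
  \sum_(j < k) \sum_(v < k) h j v * (rho c j v%:Z)%:R =
  \sum_(I : {set 'I_n} | (#|I| < k)%N && (\sum_(i in I) c i < k)%N)
    h #|I| (\sum_(i in I) c i)%N.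
Proof.
have rhoE j v : (rho c j v%:Z)%:R =
    \sum_(I : {set 'I_n}) (#|I| == j)%:R * (\sum_(i in I) c i == v)%N%:R :> R.
  rewrite /rho -sum1_card natr_sum big_mkcond /=; apply: eq_bigr => I _.
  by rewrite inE eqz_nat -natrM mulnb; case: (_ && _).
under eq_bigr do under eq_bigr do rewrite rhoE big_distrr /=.
under eq_bigr do rewrite exchange_big /=.
rewrite exchange_big [RHS]big_mkcond /=; apply: eq_bigr => I _.
set a := #|I|; set v := (\sum_(i in I) c i)%N.
under eq_bigr => j _.
  under eq_bigr => u _ do rewrite mulrA mulrAC.
  rewrite -mulr_suml (sum_delta _ (h j)).
  over.
by rewrite (sum_delta _ (fun j => if (v < k)%N then h j v else 0)); case: ifP.
Qed.

Lemma dilate_slice_Zlattice (R : realType) n (c : 'I_n -> nat) k t :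
  (0 < t)%N ->
  dilate t%:R (@slice R n k c) `&` @Zlattice R n =
  [set (\row_i (y i : nat)%:R : 'rV[R]_n) | y in
    [set` [set y : {ffun 'I_n -> 'I_(t * k).+1} |
      (\sum_i y i == t * k)%N && [forall i, y i <= t * c i]%N]%SET]].
Proof.
move=> t_gt0; have t_gt0R : 0 < t%:R :> R by rewrite ltr0n.
have t_neq0 : t%:R != 0 :> R by rewrite pnatr_eq0 -lt0n.
apply/seteqP; split=> [_ [[x [xc xk] <-] xZ]|_ [y /= + <-]].
  (* Truncation is exact, as the coordinate is a nonnegative integer; it is at most [t * k], being
     one term of a nonnegative sum. *)
  pose a i : nat := Num.trunc ((t%:R *: x) ord0 i).
  have aE i : (a i)%:R = t%:R * x ord0 i.
    have [x_ge0 _] := andP (xc i); have := xZ i; rewrite mxE => xiZ.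
    by rewrite /a mxE Num.Theory.truncnK // Num.Theory.natrEint xiZ mulr_ge0.
  have a_sum : (\sum_i a i = t * k)%N.
    apply/eqP; rewrite -(eqr_nat R) natr_sum natrM -xk mulr_sumr.
    by rewrite (eq_bigr _ (fun i _ => aE i)).
  have a_lt i : (a i < (t * k).+1)%N.
    by rewrite ltnS -a_sum (bigD1 i) //= leq_addr.
  exists [ffun i => Ordinal (a_lt i)] => /=.
    rewrite inE; apply/andP; split.
      apply/eqP; rewrite -[RHS]a_sum.
      by apply: eq_bigr => i _; rewrite ffunE.
    apply/forallP => i; rewrite ffunE /= -(ler_nat R) aE natrM.
    by rewrite ler_pM2l //; have [] := andP (xc i).
  by apply/rowP => i; rewrite mxE ffunE /= aE mxE.
rewrite inE => /andP[/eqP y_sum /forallP y_le]; split; last first.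
  by move=> i; rewrite mxE Num.Theory.natr_int.
exists (\row_i ((y i : nat)%:R / t%:R)); last first.
  by apply/rowP => i; rewrite !mxE mulrCA mulfV ?mulr1.
split=> [i|].
  rewrite mxE divr_ge0 //= ler_pdivrMr // -natrM ler_nat [(c i * t)%N]mulnC.
  exact: y_le.
under eq_bigr do rewrite mxE.
by rewrite -mulr_suml -natr_sum y_sum natrM mulrC mulKf.
Qed.

Lemma card_slice_points (R : realType) n (c : 'I_n -> nat) k t :
  (0 < n)%N -> (forall i, (0 < c i)%N) -> (0 < k)%N -> (0 < t)%N ->
  (#|[set y : {ffun 'I_n -> 'I_(t * k).+1} |
      (\sum_i y i == t * k)%N && [forall i, y i <= t * c i]%N]%SET|)%:R =
  \sum_(j < k) (-1) ^+ j * \sum_(v < k)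
    (binomp R n.-1).[t%:R * (k%:R - v%:R) + n%:R - 1 - j%:R]
      * (rho c j v%:Z)%:R.
Proof.
case: n c => // m c _ c_gt0 k_gt0 t_gt0 /=.
rewrite card_compositions_le.
under [RHS]eq_bigr => j _.
  rewrite mulr_sumr; under eq_bigr => v _ do rewrite mulrA.
  over.
rewrite (sum_rho c k (fun j v => (-1) ^+ j *
  (binomp R m).[t%:R * (k%:R - v%:R) + m.+1%:R - 1 - j%:R])).
rewrite [RHS]big_mkcond /=; apply: eq_bigr => I _.
have -> : (\sum_(i in I) (t * c i).+1 = t * \sum_(i in I) c i + #|I|)%N.
  under eq_bigr do rewrite -addn1.
  by rewrite big_split /= -big_distrr sum1_card.
set v := (\sum_(i in I) c i)%N.
have jv : (#|I| <= v)%N by rewrite -sum1_card; apply: leq_sum.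
have jm : (#|I| <= m.+1)%N by rewrite -[X in (_ <= X)%N]card_ord max_card.
(* This settles the boundary case [v = k]: there [v] is positive, hence so is [#|I|], which makes
   [t * k < t * v + #|I|] strict. *)
have j0 : #|I| = 0%N -> v = 0%N.
  by move=> /eqP; rewrite cards_eq0 /v => /eqP ->; rewrite big_set0.
move: #|I| v jv jm j0 => j v jv jm j0.
have [vk|kv] := ltnP v k; last first.
  rewrite andbF leqNgt.
  suff -> : (t * k < t * v + j)%N by rewrite mulr0.
  nia.
rewrite (leq_ltn_trans jv vk) /=; congr (_ * _).
have tkv : (t * v + t <= t * k)%N by nia.
(* The natural subtractions do not truncate, because [1 <= t * (k - v)] and [j <= m.+1]; so [binomp]
   is evaluated at a natural number. *)
have -> : t%:R * (k%:R - v%:R) + m.+1%:R - 1 - j%:R =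
    (t * (k - v) + m.+1 - 1 - j)%:R :> R.
  have kv1 : (1 <= t * (k - v))%N by rewrite muln_gt0 t_gt0 subn_gt0.
  rewrite natrB; last by lia.
  rewrite natrB; last by rewrite addnS.
  by rewrite natrD natrM natrB // ltnW.
rewrite binomp_nat mulnBr; congr (_%:R).
case: leqP => h; first by congr 'C(_, _); lia.
by rewrite bin_small //; lia.
Qed.

Theorem theorem2p5 (R : realType) (n : nat) (c : 'I_n -> nat) (k : nat)
    (n_gt0 : (0 < n)%N) (c_gt0 : forall i, (0 < c i)%N) (k_gt0 : (0 < k)%N) :
  ehr (@slice R n k c) =
    \sum_(j < k) (-1) ^+ j * \sum_(v < k)
      (binomp R n.-1 \Po ((k%:R - v%:R) *: 'X + (n%:R - 1 - j%:R)%:P))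
        * (rho c j v%:Z)%:R
  /\
  (forall t : nat, (0 < t)%N ->
    exists2 m : nat, dilate t%:R (@slice R n k c) `&` @Zlattice R n #= `I_m &
      m%:R = \sum_(j < k) (-1) ^+ j * \sum_(v < k)
        (binomp R n.-1).[t%:R * (k%:R - v%:R) + n%:R - 1 - j%:R]
          * (rho c j v%:Z)%:R).
Proof.
(* By uniqueness of the Ehrhart polynomial, the first claim reduces to the count: evaluating the
   polynomial at [t] gives the second formula. *)
set count := (X in _ /\ X); suff countP : count.
  split=> //; apply: ehrE => t t_gt0.
  have [m cardE mE] := countP t t_gt0; exists m => //; rewrite mE.
  rewrite horner_sum; apply: eq_bigr => j _.
  (* The sign is a power of -1 in [{poly R}]; it is rewritten as a constant polynomial so that
     evaluation pulls it out. *)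
  rewrite -[-1 in LHS]/(- (1%:P)) -polyCN -rmorphXn hornerCM /=; congr (_ * _).
  rewrite horner_sum; apply: eq_bigr => v _.
  rewrite -[in LHS]polyC_natr hornerM hornerC horner_comp; congr (_.[_] * _).
  by rewrite hornerD hornerZ hornerX hornerC mulrC !addrA.
move=> t t_gt0; eexists; last exact: card_slice_points.
rewrite dilate_slice_Zlattice //; apply: card_eq_imset.
  exact: [ffun=> ord0].
move=> y z /rowP yz; apply/ffunP => i; apply/val_inj/eqP.
by rewrite -(eqr_nat R); have := yz i; rewrite !mxE => ->.
Qed.
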